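(* Let $\varepsilon>0$, $\delta\in(0,1)$, and let $k,\tilde k$ be positive integers. The randomized algorithm $X\mapsto \mathsf{DPSS}(X,k,\tilde k,\varepsilon,\delta)$ (differentially private SpaceSaving, defined in the context) is $(\varepsilon,\delta)$-differentially private: for all neighboring streams $X,X'$ (in either order) and every measurable set $Z$ of outputs, $$\Pr[\mathsf{DPSS}(X,k,\tilde k,\varepsilon,\delta)\in Z]\le e^{\varepsilon}\Pr[\mathsf{DPSS}(X',k,\tilde k,\varepsilon,\delta)\in Z]+\delta .$$
   Context: Streams and neighbors. Let $\mathcal U$ be a universe of items. A stream of length $|X|=T$ is a sequence indexed by times $1,\dots,T$; an entry $\varnothing$ means that no update occurs at that time (every algorithm leaves its state unchanged). Two streams are neighboring if they differ by the addition or removal of a single update: one is $(x_1,\dots,x_T)$ and the other is $(x_1,\dots,x_{i-1},\varnothing,x_{i+1},\dots,x_T)$ for some $i$. Both are regarded as having length $T$. SpaceSaving. For a positive integer $m$, $\mathsf{SS}(X,m)$ maintains a set of tracked items $\mathcal T_t$ and counters $C_t[a]$, $a\in\mathcal T_t$, starting from $\mathcal T_0=\varnothing$. On update $x_t\in\mathcal U$ (counters and tracked items not mentioned are unchanged): (1) if $x_t\in\mathcal T_{t-1}$, set $C_t[x_t]=C_{t-1}[x_t]+1$; (2) else, if $|\mathcal T_{t-1}|<m$, set $\mathcal T_t=\mathcal T_{t-1}\cup\{x_t\}$ and $C_t[x_t]=1$; (3) else, let $S_t$ be the set of $a\in\mathcal T_{t-1}$ minimizing $C_{t-1}[a]$,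 let $y=\arg\max_{a\in S_t}\tau_{t-1}[a]$, where $\tau_s[a]$ is the last time $r\le s$ at which item $a$ occurs in the stream (so the most recently occurring minimum-count item is evicted), and set $\mathcal T_t=(\mathcal T_{t-1}\setminus\{y\})\cup\{x_t\}$, $C_t[x_t]=C_{t-1}[y]+1$. The output is the final pair $(\mathcal T,C)=(\mathcal T_T,C_T)$. Algorithm $\mathsf{DPSS}(X,k,\tilde k,\varepsilon,\delta)$. Let $\gamma=\frac1\varepsilon\ln\frac2\delta$, compute $(\mathcal T,C)=\mathsf{SS}(X,\tilde k)$, and let $\tau=\max\{|X|/k-\gamma,\ |X|/\tilde k+1+\gamma\}$. For each $x\in\mathcal T$ independently draw Laplace noise $\eta_x$ with scale $1/\varepsilon$ (density $\frac{\varepsilon}{2}e^{-\varepsilon|u|}$) and set $\hat c_x=C[x]+\eta_x$. Output $\hat{\mathcal T}=\{x\in\mathcal T:\hat c_x>\tau\}$ together with the values $\hat C[x]=\hat c_x$ for $x\in\hat{\mathcal T}$. *)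

(* Defs.v *)
From HB Require Import structures.
From mathcomp Require Import all_boot all_order all_algebra finmap.
From mathcomp Require Import all_classical all_reals all_analysis.
From mathcomp Require Import measurable_realfun.

Set Implicit Arguments.
Unset Strict Implicit.
Unset Printing Implicit Defensive.

Import Order.TTheory GRing.Theory Num.Theory.
Import numFieldNormedType.Exports.

Local Open Scope fset_scope.
Local Open Scope fmap_scope.
Local Open Scope classical_set_scope.
Local Open Scope ring_scope.

(* None is the empty update; the 1-based time t of a stream is index t.-1. *)
Definition stream (U : choiceType) := seq (option U).

Definition removal (U : choiceType) (X X' : stream U) :=
  exists (i : nat) (u : U),
    nth None X i = Some u /\ X' = set_nth None X i None.

Definition neighboring (U : choiceType) (X X' : stream U) :=
  removal X X' \/ removal X' X.

Section SpaceSaving.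
Context {U : choiceType}.
Implicit Types (X : stream U) (C : {fmap U -> nat}).

(* The last 1-based time r <= s at which a occurs in X, or 0 if there is none. *)
Definition last_time X (s : nat) (a : U) : nat :=
  (\max_(r < size X | (r < s) && (nth None X r == Some a)) r.+1)%N.

Definition min_items C : {set domf C} :=
  [set a | [forall b, C a <= C b]%N]%SET.

(* Distinct tracked items have distinct last times, so the pick is unique. *)
Definition evicted X (s : nat) C : option (domf C) :=
  [pick y in min_items C |
    [forall a in min_items C,
      last_time X s (val a) <= last_time X s (val y)]%N].

(* A state (T, C) is the finite map with domain T and values C. [ss_step m X C s]
   processes the update at time s.+1, where C is the state at time s. *)
Definition ss_step (m : nat) X C (s : nat) : {fmap U -> nat} :=
  if nth None X s is Some x then
    if C.[? x] is Some c then C.[x <- c.+1]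
    else if (#|` domf C| < m)%N then C.[x <- 1%N]
    else if evicted X s C is Some y then C.[~ val y].[x <- (C y).+1]
    else C
  else C.

Definition ss X (m : nat) : {fmap U -> nat} :=
  foldl (ss_step m X) [fmap] (iota 0 (size X)).

End SpaceSaving.

(* Centred Laplace density of scale b; the value for b <= 0 is a dummy, chosen so
   that [laplace_prob b] is a probability for every b. *)
Definition laplace_pdf {R : realType} (b x : R) : R :=
  if 0 < b then (2 * b)^-1 * expR (- (`|x| / b)) else \1_(`[0, 1]) x.

Definition laplace_prob {R : realType} (b : R) (V : set R) : \bar R :=
  (\int[lebesgue_measure]_(x in V) (laplace_pdf b x)%:E)%E.

Section laplace_probability.
Context {R : realType}.
Variable b : R.
Notation mu := (@lebesgue_measure R).

Lemma laplace_pdf_ge0 x : 0 <= laplace_pdf b x.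
Proof.
rewrite /laplace_pdf; case: ifPn => // b0.
by rewrite mulr_ge0 ?expR_ge0// invr_ge0 mulr_ge0// ltW.
Qed.

Lemma continuous_laplace_pdf : 0 < b -> continuous (laplace_pdf b).
Proof.
move=> b0 x; rewrite /laplace_pdf b0.
apply: (@continuousM _ R^o (fun=> (2 * b)^-1)
  (fun x => expR (- (`|x| / b)))); first exact: cst_continuous.
apply: continuous_comp; last exact: continuous_expR.
apply: (@continuousN _ R^o).
apply: (@continuousM _ R^o (fun x => `|x|) (fun=> b^-1)).
  exact: norm_continuous.
exact: cst_continuous.
Qed.

Lemma measurable_laplace_pdf : measurable_fun [set: R] (laplace_pdf b).
Proof.
have [b0|b0] := ltP 0 b.
  by apply: continuous_measurable_fun; exact: continuous_laplace_pdf.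
rewrite (_ : laplace_pdf b = \1_(`[0, 1])); first exact: measurable_indic.
by apply/funext => x; rewrite /laplace_pdf ltNge b0.
Qed.

Lemma integral_laplace_pdf : (\int[mu]_x (laplace_pdf b x)%:E = 1)%E.
Proof.
have [b0|b0] := ltP 0 b; last first.
  under eq_integral do rewrite /laplace_pdf ltNge b0/=.
  by rewrite integral_indic//= setIT lebesgue_measure_itv/= lte01 oppr0 adde0.
rewrite ge0_symfun_integralT//=; last 3 first.
- exact: laplace_pdf_ge0.
- exact: continuous_laplace_pdf.
- by move=> x /=; rewrite /laplace_pdf b0 normrN.
have -> : [set x : R | 0 <= x] = `[0, +oo[%classic.
  by apply/seteqP; split => x /=; rewrite in_itv/= andbT.
have bV0 : 0 < b^-1 by rewrite invr_gt0.
under eq_integral => x.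
  rewrite inE/= in_itv/= andbT => x0.
  rewrite (_ : laplace_pdf b x = 2^-1 * exponential_pdf b^-1 x); last first.
    rewrite exponential_pdfE// /laplace_pdf b0 ger0_norm// invfM mulrA.
    by congr (_ * expR _); rewrite mulNr mulrC.
  rewrite EFinM; over.
rewrite ge0_integralZl//=; last 2 first.
- apply/measurable_EFinP; apply: measurable_funTS.
  exact: measurable_exponential_pdf.
- by move=> x _; rewrite lee_fin exponential_pdf_ge0// ltW.
have -> : (\int[mu]_(x in `[0%R, +oo[) (exponential_pdf b^-1 x)%:E = 1)%E.
  rewrite -(integral_exponential_pdf bV0) [in LHS]integral_mkcond/=.
  apply: eq_integral => x _; rewrite patchE; case: ifPn => //.
  rewrite notin_setE/= in_itv/= andbT => /negP; rewrite -ltNge => x0.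
  by rewrite lt0_exponential_pdf.
by rewrite mule1 -EFinM divff.
Qed.

Let laplace0 : laplace_prob b set0 = 0%E.
Proof. by rewrite /laplace_prob integral_set0. Qed.

Let laplace_ge0 A : (0 <= laplace_prob b A)%E.
Proof. by apply: integral_ge0 => x _; rewrite lee_fin laplace_pdf_ge0. Qed.

Let laplace_sigma_additive : semi_sigma_additive (laplace_prob b).
Proof.
move=> /= F mF tF mUF; rewrite /laplace_prob; apply: cvg_toP.
  apply: ereal_nondecreasing_is_cvgn => m n mn.
  apply: lee_sum_nneg_natr => // k _ _; apply: integral_ge0 => /= x Fkx.
  by rewrite lee_fin laplace_pdf_ge0.
rewrite ge0_integral_bigcup//=.
- apply/measurable_funTS/measurableT_comp => //.
  exact: measurable_laplace_pdf.
- by move=> x _; rewrite lee_fin laplace_pdf_ge0.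
Qed.

HB.instance Definition _ := isMeasure.Build _ _ _
  (laplace_prob b) laplace0 laplace_ge0 laplace_sigma_additive.

Let laplace_setT : laplace_prob b [set: R] = 1%E.
Proof. exact: integral_laplace_pdf. Qed.

HB.instance Definition _ :=
  @Measure_isProbability.Build _ _ R (laplace_prob b) laplace_setT.

End laplace_probability.

Section iid.
Context {d} {T : measurableType d} {R : realType}.

Definition cons_tuple n (p : T * n.-tuple T) : n.+1.-tuple T :=
  [tuple of p.1 :: p.2].

Lemma measurable_cons_tuple n :
  measurable_fun [set: T * n.-tuple T] (@cons_tuple n).
Proof. exact: measurable_cons. Qed.

HB.instance Definition _ n := @isMeasurableFun.Build _ _ _ _
  (@cons_tuple n) (@measurable_cons_tuple n).

(* The n-fold product measure of P, i.e. the law of n independent draws. *)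
Fixpoint iid (P : probability T R) n : probability (n.-tuple T) R :=
  if n is n'.+1 then distribution (P \x iid P n')%E (@cons_tuple n')
  else \d_([tuple] : 0.-tuple T).

End iid.

Definition measure_fmap_display : measure_display -> measure_display.
Proof. exact. Qed.

Definition fmap_of_tuple (U : choiceType) (V : Type) (S : {fset U})
    (v : #|{: S}|.-tuple V) : {fmap U -> V} :=
  [fmap x : S => tnth v (enum_rank x)].

Section measurable_fmap.
Context (U : choiceType) {d} {V : measurableType d}.

HB.instance Definition _ := isPointed.Build {fmap U -> V} [fmap].

(* {fmap U -> V} is the disjoint union, over the finite sets S, of the products
   V^S; it carries the disjoint-union sigma-algebra. *)
Definition fmap_measurable : set (set {fmap U -> V}) :=
  [set Z | forall S : {fset U}, measurable (@fmap_of_tuple U V S @^-1` Z)].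

Let fmap_set0 : fmap_measurable set0.
Proof. by move=> S; rewrite preimage_set0. Qed.

Let fmap_setC Z : fmap_measurable Z -> fmap_measurable (~` Z).
Proof. by move=> mZ S; rewrite preimage_setC; apply: measurableC; exact: mZ. Qed.

Let fmap_bigcup (F : (set {fmap U -> V})^nat) :
  (forall i, fmap_measurable (F i)) -> fmap_measurable (\bigcup_i F i).
Proof.
by move=> mF S; rewrite preimage_bigcup; apply: bigcup_measurable => i _; exact: mF.
Qed.

HB.instance Definition _ := @isMeasurable.Build (measure_fmap_display d)
  {fmap U -> V} fmap_measurable fmap_set0 fmap_setC fmap_bigcup.

Lemma measurable_fmap_of_tuple (S : {fset U}) :
  measurable_fun [set: #|{: S}|.-tuple V] (@fmap_of_tuple U V S).
Proof. by move=> _ Z mZ; rewrite setTI; exact: mZ. Qed.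

End measurable_fmap.

Section DPSS.
Context {U : choiceType} {R : realType}.

(* Tracked items are numbered by [enum_rank]; item x receives the noise of that
   index. *)
Definition noisy_counts (C : {fmap U -> nat})
    (eta : #|{: domf C}|.-tuple R) : {fmap U -> R} :=
  [fmap x : domf C => (C x)%:R + tnth eta (enum_rank x)].

Definition release (tau : R) (c : {fmap U -> R}) : {fmap U -> R} :=
  c.[& [fsetval x in {: domf c} | tau < c x]].

Definition dpss_output (tau : R) (C : {fmap U -> nat})
    (eta : #|{: domf C}|.-tuple R) : {fmap U -> R} :=
  release tau (noisy_counts eta).

Lemma restrict_noisy_counts C (A : {fset U}) (sAC : (A `<=` domf C)%fset)
    (eta : #|{: domf C}|.-tuple R) :
  (noisy_counts eta).[& A] = fmap_of_tuple
    [tuple (C (fincl sAC (enum_val j)))%:R +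
           tnth eta (enum_rank (fincl sAC (enum_val j))) | j < #|{: A}|].
Proof.
apply/fmapP => u; rewrite fnd_restrict.
have [uA|uA] := boolP (u \in A); last by rewrite not_fnd.
have uC : u \in domf C by exact: (fsubsetP sAC).
rewrite (in_fnd (f := noisy_counts eta) uC) (in_fnd (f := fmap_of_tuple _) uA).
rewrite !ffunE tnth_mktuple enum_rankK.
by rewrite (_ : fincl sAC _ = [` uC])//; exact: val_inj.
Qed.

Lemma measurable_dpss_output tau C :
  measurable_fun [set: #|{: domf C}|.-tuple R] (@dpss_output tau C).
Proof.
move=> _ Z mZ; rewrite setTI.
have mcount x : measurable_fun [set: #|{: domf C}|.-tuple R]
    (fun eta => (C x)%:R + tnth eta (enum_rank x)).
  by apply: measurable_funD; [exact: measurable_cst|exact: measurable_tnth].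
pose key (S : {set domf C}) : {fset U} := [fsetval x in S].
have -> : @dpss_output tau C @^-1` Z = \bigcup_(S in [set: {set domf C}])
    (\bigcap_(x in [set: domf C])
       [set eta | (tau < (C x)%:R + tnth eta (enum_rank x))%R = (x \in S)] `&`
     [set eta | Z (noisy_counts eta).[& key S]]).
  have E eta (S : {set domf C}) : (forall x,
      (tau < (C x)%:R + tnth eta (enum_rank x)) = (x \in S)) ->
      dpss_output tau eta = (noisy_counts eta).[& key S].
    move=> ES; rewrite /dpss_output /release; congr (_ .[& _]).
    rewrite /key; apply/fsetP => u.
    apply/imfsetP/imfsetP => -[/= x xS ->]; exists x => //=.
    + by move: xS; rewrite -ES => /[!inE]/=; rewrite ffunE.
    + by rewrite unfold_in/= ffunE ES.
  apply/seteqP; split => eta /=.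
    move=> Zeta.
    pose S : {set domf C} :=
      [set x | tau < (C x)%:R + tnth eta (enum_rank x)]%SET.
    exists S => //; split; first by move=> x _ /=; rewrite inE.
    by rewrite /= -E// => x; rewrite inE.
  by move=> [S _ [ES ZS]]; rewrite (E _ S)// => x; exact: ES.
apply: fin_bigcup_measurable => [|S _]; first exact: finite_finset.
apply: measurableI.
  apply: fin_bigcap_measurable => [|x _]; first exact: finite_finset.
  have m : measurable_fun [set: #|{: domf C}|.-tuple R]
      (fun eta => tau < (C x)%:R + tnth eta (enum_rank x)).
    by apply: measurable_fun_ltr => //; exact: mcount.
  by rewrite -[X in measurable X]setTI; exact: (m measurableT [set x \in S]).
have sSC : (key S `<=` domf C)%fset.
  by apply/fsubsetP => u /imfsetP[/= x _ ->]; exact: valP.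
rewrite (_ : mkset _ = (fun eta : #|{: domf C}|.-tuple R => fmap_of_tuple
    [tuple (C (fincl sSC (enum_val j)))%:R +
       tnth eta (enum_rank (fincl sSC (enum_val j))) | j < #|{: key S}|])
    @^-1` Z); last first.
  by apply/seteqP; split => eta /=; rewrite (restrict_noisy_counts sSC).
rewrite -[X in measurable X]setTI.
apply: (measurableT_comp (measurable_fmap_of_tuple (S := key S))) => //.
apply/measurable_fun_tnthP => i.
rewrite (_ : _ \o _ = fun eta => (C (fincl sSC (enum_val i)))%:R +
       tnth eta (enum_rank (fincl sSC (enum_val i)))); first exact: mcount.
by apply/funext => eta /=; rewrite tnth_mktuple.
Qed.

HB.instance Definition _ tau C := @isMeasurableFun.Build _ _ _ _
  (@dpss_output tau C) (@measurable_dpss_output tau C).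

(* The law of the output of DPSS; k' is the number of counters. *)
Definition dpss (X : stream U) (k k' : nat) (eps delta : R) :
    probability {fmap U -> R} R :=
  let gamma := eps^-1 * ln (2 / delta) in
  let C := ss X k' in
  let tau := Num.max ((size X)%:R / k%:R - gamma)
                     ((size X)%:R / k'%:R + 1 + gamma) in
  distribution (iid (laplace_prob eps^-1 : probability R R) #|{: domf C}|) (@dpss_output tau C).

End DPSS.

Definition differentially_private {U : choiceType} {d} {T : measurableType d}
    {R : realType} (eps delta : R) (M : stream U -> probability T R) :=
  forall X X' : stream U, neighboring X X' -> forall Z : set T, measurable Z ->
    (M X Z <= (expR eps)%:E * M X' Z + delta%:E)%E.

(* Main.v *)
(* Pad the SpaceSaving state with placeholder items of count 0 so that it always
   tracks exactly k' items; every update then replaces one tracked (item, count)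
   pair (y, n) by (w, n + 1), where y is either the requested item w or the
   victim.  Couple the runs on X and X' after the removed update: at all times the
   two states agree except for one pair z, v of slots with counts l + 1 and l, and
   possibly a second pair x, q of slots with equal minimal count p.  Because the
   most recent minimal item is evicted, this shape is preserved.  Hence each side
   tracks at most two items that the other does not, these have count at most
   |X| / k' + 1, and at most one common count differs, by 1.

   An item tracked on one side only exceeds the threshold with probability at
   most P(eta > gamma) = delta / 4, so the four of them cost delta in total.  On
   the common items the product structure of the noise reduces the comparison to
   shifting one Laplace coordinate by at most 1, which costs the factor
   exp(eps). *)

Require Import Defs.
From HB Require Import structures.
From mathcomp Require Import all_boot all_order all_algebra finmap.
From mathcomp Require Import all_classical all_reals all_analysis.
From mathcomp Require Import measurable_realfun.
From mathcomp Require Import zify ring lra.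

Set Implicit Arguments.
Unset Strict Implicit.
Unset Printing Implicit Defensive.

(** * Coupled counter states *)

Section CoupledStates.
Variable E : eqType.
Implicit Types (c : E -> option nat) (t : E -> nat).

Definition lower_bound c n := forall a b, c a = Some b -> (n <= b)%N.

Definition replace c y w n : E -> option nat :=
  fun a => if a == w then Some n.+1 else if a == y then None else c a.

(* Slot [(y, n)] is the one that a request for [w] turns into [(w, n.+1)]. *)
Definition victim c t w y n :=
  c y = Some n /\ (y = w \/ [/\ c w = None, lower_bound c n &
    forall a, c a = Some n -> (t a <= t y)%N]).

(* The case [z = v] is that of a common item whose counts differ.  The recency
   condition in [Coupled2] keeps a state with two unmatched pairs
   from acquiring a third one: the side of [c'] evicts [q] or [v] before any
   common item. *)
Inductive coupled t' c c' : Prop :=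
| Coupled1 z l v of
    c z = Some l.+1 & c' v = Some l &
    (forall a, a = z \/ a = v \/ c a = c' a) &
    (z <> v -> [/\ c v = None, c' z = None & lower_bound c' l])
| Coupled2 x y p z l v of
    c x = Some p & c' x = None & c y = None & c' y = Some p &
    c z = Some l.+1 & c' v = Some l &
    (forall a, a = x \/ a = y \/ a = z \/ a = v \/ c a = c' a) &
    lower_bound c p & lower_bound c' p &
    (z <> v -> [/\ l = p, y <> v, c v = None, c' z = None &
      exists2 u, u = y \/ u = v &
        forall a, c a = Some p -> c' a = Some p -> (t' a <= t' u)%N]).

(** Recency thus breaks every tie between tracked slots of equal count, so an evicted slot is
    unique. *)
Definition tracked_inj c t :=
  forall a b n m, c a = Some n -> c b = Some m -> t a = t b -> a = b.




Ltac by_disjunct := first [congruence | left; by_disjunct | right; by_disjunct].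

Ltac by_cases_on_pair :=
  first [by_disjunct | match goal with H : _ = _ \/ _ |- _ =>
    destruct H as [H|H]; [subst; by_disjunct|
      repeat match type of H with _ /\ _ =>
        let K := fresh in destruct H as [K H] end; by_disjunct] end].

Ltac ifs := rewrite /replace; do ![case: eqP => ? //]; by_cases_on_pair.

(** For the agreement clause of a new state: slots that neither [replace] touches inherit it from
    the old clause [A]. *)
Ltac agree A :=
  let a := fresh "a" in let Aa := fresh in move=> a; have Aa := A a;
  rewrite /replace; do ![case: eqP => ? //]; first [by_disjunct |
  repeat match type of Aa with _ \/ _ => destruct Aa as [Aa|Aa] end; by_cases_on_pair].

(** For a lower bound after [replace]: the new count is compared by arithmetic, and an old count
    through a bound on either side, transferred by [A]. *)
Ltac lower A :=
  let a := fresh "a" in let b := fresh "b" in let Aa := fresh in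
  move=> a b; have Aa := A a;
  rewrite /replace; do ![case: eqP => ? //]; try (by move=> [?]; lia);
  move=> ?;
  repeat match type of Aa with _ \/ _ => destruct Aa as [Aa|Aa] end;
  subst; first [by_cases_on_pair | match goal with
  | L : lower_bound ?c ?n |- _ =>
    let K := fresh in have K : (n <= b)%N by [apply: (L a b); congruence]; lia
  | L : lower_bound ?c ?n, H : ?c ?u = Some b |- _ => have := L u b H; lia
  | H : _ = Some ?k |- _ => have : k = b by [congruence]; lia end].

(** Here [t2] gives the times of the primed side after the request. Each victim is either a
    distinguished slot or a slot on which [c] and [c'] agree; the cases run through the positions of
    both victims, and each one either is contradictory or yields the next shape. *)
Lemma coupled_step t t' t2 c c' w y n y' n' :
  (forall a m, c a = Some m -> c' a = Some m -> t a = t' a) ->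
  tracked_inj c t -> tracked_inj c' t' ->
  (forall a, a <> w -> t2 a = t' a) ->
  coupled t' c c' -> victim c t w y n -> victim c' t' w y' n' ->
  coupled t2 (replace c y w n) (replace c' y' w n').
Proof.
move=> ts injt injt' t2E + [cy vy] [c'y' vy'].
(* Two evicted common slots have equal counts, each being minimal on its side. Each is then at least
   as recent as the other, and times are injective. *)
have common_victims : c y = c' y -> c y' = c' y' -> y = y'.
  move=> e e'; case: vy => [yw|[cw lc tc]]; case: vy' => [y'w|[c'w lc' tc']].
  - congruence.
  - congruence.
  - congruence.
  - have nn : n = n'.
      have := lc y' n'; have := lc' y n; rewrite e' -e cy c'y'.
      move=> /(_ erefl) ? /(_ erefl) ?; lia.
    subst n'; have cy' : c y' = Some n by congruence.
    have c'y : c' y = Some n by congruence.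
    have := tc y' cy'; have := tc' y c'y.
    rewrite -(ts y n)// -(ts y' n)// => h1 h2.
    by apply: (injt _ _ n n) => //; lia.
move=> [z l v cz cv A zv|x q p z l v cx c'x cq c'q cz cv A lc lc' zv].
- have zvD : z = v \/ (z <> v /\ c v = None /\ c' z = None).
    by case: (eqVneq z v) => [|/eqP zv0]; [left|right; case: (zv zv0)].
  have yD : y = z \/ [/\ y <> z, y <> v & c y = c' y].
    case: (eqVneq y z) => [|/eqP yz]; first tauto.
    right; split => //; first by move=> ?; subst; intuition congruence.
    by move: (A y) => [?|[?|//]]; subst; intuition congruence.
  have y'D : y' = v \/ [/\ y' <> z, y' <> v & c y' = c' y'].
    case: (eqVneq y' v) => [|/eqP yz]; first tauto.
    right; split => //; first by move=> ?; subst; intuition congruence.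
    by move: (A y') => [?|[?|//]]; subst; intuition congruence.
  case: yD y'D => [yz|[yz yv cyy]] [y'v|[y'z y'v cyy']].
  (* Both discrepant slots turn into [w], with counts [l.+2] and [l.+1]. *)
  + subst y y'; apply: (@Coupled1 _ _ _ w l.+1 w).
    * ifs.
    * ifs.
    * agree A.
    * by [].
  (* The request is for [z]: as an evicted slot [z] would be minimal, but [y'] has count at most
     [l]. The primed side evicts [y'], so [y'] and [v] become a second pair of minimal count [l]. *)
  + subst y; have nl : n = l.+1 by congruence.
    subst n; case: vy' => [y'w|[c'w lc' tc']].
      by case: vy => [|[cw _ _]]; congruence.
    have n'l : (n' <= l)%N by exact: (lc' v).
    case: vy => [zw|[cw lc tc]]; last first.
      have := lc y' n'; rewrite cyy' c'y' => /(_ erefl); lia.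
    subst w; have zv' : z <> v by congruence.
    have {zv}[cv' c'z lcl] := zv zv'.
    have e : n' = l by have := lcl y' _ c'y'; lia.
    subst n'; apply: (@Coupled2 _ _ _ y' v l z l.+1 z); try ifs.
    * agree A.
    * lower A.
    * lower A.
  (* The victim [y] has count [l] or [l.+1]. With [l] it takes over the role of [v]; with [l.+1] it
     forms the minimal pair with [z], and [w] carries the difference of one. *)
  + subst y'; have nl : n' = l by congruence.
    subst n'.
    case: vy => [yw|[cw lc tc]].
      by case: vy' => [|[cw _ _]]; congruence.
    have nl : (n <= l.+1)%N by exact: (lc z).
    have ln : (l <= n)%N.
      case: vy' => [vw|[c'w lc' tc']]; last by apply: (lc' y); congruence.
      have {zv}[_ _ lcl] := zv ltac:(congruence).
      by apply: (lcl y); congruence.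
    have [nl'|nl'] : n = l \/ n = l.+1 by lia.
    * subst n; apply: (@Coupled1 _ _ _ z l y); try ifs.
      - agree A.
      - move=> _; split; try ifs.
        lower A.
    * subst n; apply: (@Coupled2 _ _ _ z y l.+1 w l.+1 w); try ifs.
      - agree A.
      - lower A.
      - lower A.
  + have e := common_victims cyy cyy'; subst y'.
    have e : n = n' by congruence.
    subst n'.
    have zw : z <> w by move=> ?; subst; case: vy => [|[cw _ _]]; congruence.
    have vw : v <> w by move=> ?; subst; case: vy' => [|[cw _ _]]; congruence.
    apply: (@Coupled1 _ _ _ z l v); try ifs.
    * agree A.
    * move=> zv'; have [cv' c'z lcl] := zv zv'; split; try ifs.
      have ln : (l <= n)%N by apply: (lcl y); congruence.
      lower A.
- have xz : x <> z.
    move=> ?; subst; case: (eqVneq z v) => [|/eqP /zv[? ? ? ? _]].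
      by congruence.
    have : p = l.+1 by congruence.
    by lia.
  have qv : q <> v.
    by case: (eqVneq z v) => [|/eqP /zv[]//]; congruence.
  have zvD : z = v \/ (z <> v /\ l = p /\ c v = None /\ c' z = None).
    by case: (eqVneq z v) => [|/eqP zv0]; [left|right; case: (zv zv0)].
  have yD : [\/ y = x, y = z | [/\ y <> x, y <> z, y <> q, y <> v & c y = c' y]].
    case: (eqVneq y x) => [|/eqP yx]; first by constructor 1.
    case: (eqVneq y z) => [|/eqP yz]; first by constructor 2.
    constructor 3; split=> //; try by move=> ?; subst; intuition congruence.
    by move: (A y) => [?|[?|[?|[?|//]]]]; subst; intuition congruence.
  have y'D : [\/ y' = q, y' = v |
      [/\ y' <> x, y' <> z, y' <> q, y' <> v & c y' = c' y']].
    case: (eqVneq y' q) => [|/eqP yx]; first by constructor 1.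
    case: (eqVneq y' v) => [|/eqP yz]; first by constructor 2.
    constructor 3; split=> //; try by move=> ?; subst; intuition congruence.
    by move: (A y') => [?|[?|[?|[?|//]]]]; subst; intuition congruence.
  have lp : (p <= l)%N by exact: (lc' v).
  (* If a common slot [y'] of count [p] were most recent on the primed side, the witness [u], also
     of count [p], would share its time. *)
  have victim_q : z <> v -> c y' = c' y' -> n' = p -> y' <> q -> y' <> v ->
      ~ (forall a, c' a = Some n' -> (t' a <= t' y')%N).
    move=> /zv[e _ _ _ [u uqv uP]] cyy' n'p y'q y'v tc'; subst l n'.
    have c'u : c' u = Some p by case: uqv => ->.
    have uy' : t' u = t' y'.
      by have := uP y'; rewrite cyy' c'y' => /(_ erefl erefl);
        have := tc' u c'u; lia.
    by have := injt' u y' p p c'u c'y' uy'; case: uqv; congruence.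
  (* A common slot evicted by [c] was the most recent one of count [p]. If the primed side keeps it,
     it serves as the witness [u] of the new state. *)
  have victim_newest : c y = c' y -> n = p -> y <> w ->
      (forall a, c a = Some n -> (t a <= t y)%N) -> (p <= n')%N ->
      forall a, replace c y w n a = Some p -> replace c' y' w n' a = Some p ->
      (t2 a <= t2 y)%N.
    move=> cyy np yw tc pn' a; subst n; rewrite /replace.
    case: eqP => [_ [?]|aw]; first lia.
    case: eqP => [//|ay]; case: eqP => [//|ay'] ca c'a.
    rewrite !t2E// -(ts a p)// -(ts y p)//; last by congruence.
    exact: tc.
  case: yD y'D => [yx|yz|[yx yz yq yv cyy]] [y'q|y'v|[y'x y'z y'q y'v cyy']].
  (* The minimal pair merges into [w] and disappears. *)
  + subst y y'; have [? ?] : n = p /\ n' = p by split; congruence.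
    subst n n'.
    have zw : z <> w.
      move=> ?; subst; case: vy => [|[cw _ _]]; congruence.
    have vw : v <> w.
      move=> ?; subst; case: vy' => [|[cw _ _]]; congruence.
    apply: (@Coupled1 _ _ _ z l v); try ifs.
    * agree A.
    * move=> zv'; have [? _ cv' c'z _] := zv zv'; subst l; split; try ifs.
      lower A.
  (* Here [l = p], and [q] replaces [v] as the partner of [z]. *)
  + subst y y'; have [? ?] : n = p /\ n' = l by split; congruence.
    subst n n'.
    have zw : z <> w.
      by move=> ?; subst; case: vy => [|[cw _ _]]; congruence.
    have qw : q <> w.
      by move=> ?; subst; case: vy' => [|[cw _ _]]; congruence.
    have e : l = p.
      case: vy' => [vw|[c'w lc2 _]]; last by have := lc2 q p c'q; lia.
      by intuition congruence.
    subst l; apply: (@Coupled1 _ _ _ z p q); try ifs.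
    * agree A.
    * move=> zq; split; try ifs.
      lower A.
  (* By [victim_q] this needs [z = v]; then [y'] takes over the role of [x]. *)
  + subst y; have np : n = p by congruence.
    subst n; case: vy' => [y'w|[c'w lc2 tc']].
      by case: vy => [|[cw _ _]]; congruence.
    have n'p : n' = p by have := lc2 q p c'q; have := lc' y' n' c'y'; lia.
    have zv0 : z = v.
      by case: (eqVneq z v) => // /eqP zv0; case: (victim_q zv0).
    subst v n'; apply: (@Coupled2 _ _ _ y' q p z l z); try ifs.
    * agree A.
    * lower A.
    * lower A.
  (* The count of [z] exceeds that of [x], so [z] is requested, not evicted. On the primed side it
     replaces [q], which leaves [v] as the partner of [x]. *)
  + subst y y'; have [? ?] : n = l.+1 /\ n' = p by split; congruence.
    subst n n'; case: vy => [zw|[_ lc2 _]]; last by have := lc2 x p cx; lia.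
    have zv0 : z <> v by case: vy' => [|[? _ _]]; congruence.
    have e : l = p by tauto.
    subst w l; apply: (@Coupled2 _ _ _ x v p z p.+1 z); try ifs.
    * agree A.
    * lower A.
    * lower A.
  + subst y y'; have [? ?] : n = l.+1 /\ n' = l by split; congruence.
    subst n n'; case: vy => [zw|[_ lc2 _]]; last by have := lc2 x p cx; lia.
    subst w; apply: (@Coupled2 _ _ _ x q p z l.+1 z); try ifs.
    * agree A.
    * lower A.
    * lower A.
  + subst y; have np : n = l.+1 by congruence.
    subst n; case: vy => [zw|[_ lc2 _]]; last by have := lc2 x p cx; lia.
    subst w; case: vy' => [|[c'w lc2 tc']]; first by congruence.
    have zv0 : z <> v by congruence.
    have n'p : n' = p by have := lc2 q p c'q; have := lc' y' n' c'y'; lia.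
    by case: (victim_q zv0).
  (* Now [y], lost by [c] and kept by [c'], takes over the role of [q]. *)
  + subst y'; have n'p : n' = p by congruence.
    have yw : y <> w by case: vy' => [|[? _ _]]; congruence.
    have qvw : v <> w by case: vy' => [|[? _ _]]; congruence.
    case: vy => [//|[cw lc2 tc]].
    have np : n = p by have := lc2 x p cx; have := lc y n cy; lia.
    have newest := victim_newest cyy np yw tc.
    subst n n'; apply: (@Coupled2 _ _ _ x y p z l v); try ifs.
    * agree A.
    * lower A.
    * lower A.
    * move=> zv0; have [e _ cv' c'z _] := zv zv0; split=> //; try ifs.
      by exists y; [left|exact: newest].
  (* Again [l = p], and [y] takes over the role of [v]. *)
  + subst y'; have n'l : n' = l by congruence.
    have yw : y <> w by case: vy' => [|[? _ _]]; congruence.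
    case: (vy) => [//|[cw lc2 tc]].
    have np : n = p by have := lc2 x p cx; have := lc y n cy; lia.
    have e : l = p.
      case: vy' => [vw|[c'w lc3 _]]; last by have := lc3 q p c'q; lia.
      by intuition congruence.
    have qw : q <> w by case: vy' => [|[? _ _]]; congruence.
    have newest := victim_newest cyy np yw tc.
    subst n n' l; apply: (@Coupled2 _ _ _ x q p z p y); try ifs.
    * agree A.
    * lower A.
    * lower A.
    * move=> zy; split=> //; try ifs; try congruence.
      by exists y; [right|exact: newest].
  + have e := common_victims cyy cyy'; subst y'.
    have e : n = n' by congruence.
    have pn : (p <= n)%N by exact: (lc y).
    subst n'.
    have xw : x <> w by move=> ?; subst; case: vy => [|[cw _ _]]; congruence.
    have zw : z <> w by move=> ?; subst; case: vy => [|[cw _ _]]; congruence.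
    have qw : q <> w by move=> ?; subst; case: vy' => [|[cw _ _]]; congruence.
    have vw : v <> w by move=> ?; subst; case: vy' => [|[cw _ _]]; congruence.
    apply: (@Coupled2 _ _ _ x q p z l v); try ifs.
    * agree A.
    * lower A.
    * lower A.
    * move=> zv0; have [e qv' cv' c'z [u uqv uP]] := zv zv0; split=> //; try ifs.
      exists u => // a; rewrite /replace.
      case: eqP => [_ [?]|aw]; first lia.
      case: eqP => [//|ay] ca c'a.
      rewrite !t2E//; last by case: uqv => ->.
      exact: uP.
Qed.

(** What privacy needs from the coupling: [p] bounds the unmatched counts up to one and is itself
    bounded by all counts of one side, hence by their average. *)
Lemma coupled_close t' c c' : coupled t' c c' -> exists p : nat, [/\
  lower_bound c p \/ lower_bound c' p,
  (exists x y, forall a n, c a = Some n -> c' a = None ->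
     (a = x \/ a = y) /\ (n <= p.+1)%N),
  (exists x y, forall a n, c' a = Some n -> c a = None ->
     (a = x \/ a = y) /\ (n <= p.+1)%N) &
  exists z, forall a n n', c a = Some n -> c' a = Some n' ->
     n = n' \/ a = z /\ (n <= n'.+1)%N /\ (n' <= n.+1)%N].
Proof.
case=> [z l v cz cv A zv|x q p z l v cx c'x cq c'q cz cv A lc lc' zv].
- have {zv}zvP : z = v \/ [/\ c v = None, c' z = None & lower_bound c' l].
    by case: (eqVneq z v) => [|/eqP/zv]; [left|right].
  (* When [z = v] no slot is unmatched, so the trivial lower bound 0 suffices. *)
  exists (if z == v then 0%N else l); split.
  + case: zvP => [->|[? ? ?]]; first by rewrite eqxx; left.
    by case: eqP; [left|right].
  + exists z, v => a n ca c'a; case: zvP => [?|[cv' c'z _]].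
      by subst v; case: (A a) => [?|[?|?]]; subst; congruence.
    have -> : a = z by case: (A a) => [?|[?|?]]; subst; congruence.
    split; [by left|]; case: eqP => [|_]; first by congruence.
    case: (A a) => [?|[?|?]]; subst; try congruence.
    by have -> : n = l.+1 by congruence.
  + exists z, v => a n ca c'a; case: zvP => [?|[cv' c'z _]].
      by subst v; case: (A a) => [?|[?|?]]; subst; congruence.
    have -> : a = v by case: (A a) => [?|[?|?]]; subst; congruence.
    split; [by right|]; case: eqP => [|_]; first by congruence.
    case: (A a) => [?|[?|?]]; subst; try congruence.
    by have -> : n = l by congruence.
  + exists z => a n n' ca c'a; case: zvP => [?|[cv' c'z _]]; last first.
      by left; case: (A a) => [?|[?|?]]; subst; congruence.
    subst v; case: (eqVneq a z) => [?|/eqP az]; last first.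
      by left; case: (A a) => [?|[?|?]]; subst; congruence.
    subst a; right; split=> //; have -> : n = l.+1 by congruence.
    by have -> : n' = l by [congruence]; split; rewrite ?leqnn// leqW.
- have {zv}zvP : z = v \/ [/\ c v = None, c' z = None & l = p].
    by case: (eqVneq z v) => [|/eqP/zv[]]; [left|right].
  exists p; split; first by left.
  + exists x, z => a n ca c'a; case: (A a) => [?|[?|[?|[?|?]]]]; try subst a.
    * by split; [left|have -> : n = p by congruence].
    * by congruence.
    * split; [by right|case: zvP => [?|[_ _ ?]]; first by congruence].
      by subst l; have -> : n = p.+1 by congruence.
    * by congruence.
    * by congruence.
  + exists q, v => a n ca c'a; case: (A a) => [?|[?|[?|[?|?]]]]; try subst a.
    * by congruence.
    * by split; [left|have -> : n = p by congruence].
    * by congruence.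
    * split; [by right|case: zvP => [?|[_ _ ?]]; first by congruence].
      by subst l; have -> : n = p by congruence.
    * by congruence.
  + exists z => a n n' ca c'a.
    case: (eqVneq a z) => [?|/eqP az]; last first.
      left; case: (A a) => [?|[?|[?|[?|?]]]]; try (subst a; congruence);
        last by congruence.
      by subst a; case: zvP => [?|[? _ _]]; congruence.
    subst a; case: zvP => [?|[_ ? _]]; last by congruence.
    subst v; right; split=> //; have -> : n = l.+1 by congruence.
    by have -> : n' = l by [congruence]; split; rewrite ?leqnn// leqW.
Qed.
End CoupledStates.

(** * Coupled runs of SpaceSaving *)

Local Open Scope fset_scope.
Local Open Scope fmap_scope.

Section SpaceSavingRun.
Variable U : choiceType.
Implicit Types (X : stream U) (C : {fmap U -> nat}) (m s : nat).

Lemma last_timeS X s a : last_time X s.+1 a =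
  (if nth None X s == Some a then s.+1 else last_time X s a)%N.
Proof.
rewrite /last_time; case: eqP => Xs; last first.
  apply: eq_bigl => r; rewrite ltnS leq_eqVlt.
  by case: eqP => //= ->; rewrite ltnn; apply/eqP.
have sX : (s < size X)%N.
  by rewrite ltnNge; apply/negP => /(nth_default None); rewrite Xs.
apply/eqP; rewrite eqn_leq; apply/andP; split.
  by apply/bigmax_leqP => r /andP[].
by rewrite (bigD1 (Ordinal sX))/= ?ltnS ?leqnn ?Xs ?eqxx// leq_maxl.
Qed.

Lemma last_time0 X a : last_time X 0 a = 0%N.
Proof. by rewrite /last_time big_pred0. Qed.

Lemma nth_last_time X s a : (0 < last_time X s a)%N ->
  nth None X (last_time X s a).-1 = Some a.
Proof.
elim: s => [|s IH]; first by rewrite last_time0.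
by rewrite last_timeS; case: eqP.
Qed.

Lemma last_time_inj X s a b : (0 < last_time X s a)%N ->
  last_time X s a = last_time X s b -> a = b.
Proof.
move=> a0 ab; have := nth_last_time a0; rewrite ab nth_last_time -?ab//.
by case.
Qed.

(* Each unused counter is a placeholder [inr j] of count 0.  Real items carry
   later times than placeholders, and the placeholder with the largest index is
   the one that the next new item replaces. *)
Definition slots m C (e : U + nat) : option nat :=
  match e with
  | inl a => C.[? a]
  | inr j => if (j + #|` domf C| < m)%N then Some 0%N else None
  end.

Definition slot_times m X s (e : U + nat) : nat :=
  match e with inl a => (m + last_time X s a)%N | inr j => j end.

Definition total C : nat := (\sum_(a <- domf C) odflt 0 C.[? a])%N.

Let sum_ext (A B : {fset U}) (f g : U -> nat) : A = B -> {in A, f =1 g} ->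
  (\sum_(a <- A) f a = \sum_(a <- B) g a)%N.
Proof. by move=> <- fg; apply: eq_big_seq => a /fg. Qed.

Let totalE C x :
  total C = (odflt 0 C.[? x] + \sum_(a <- domf C `\ x) odflt 0 C.[? a])%N.
Proof.
rewrite /total; have [xC|xC] := boolP (x \in domf C).
  by rewrite (big_fsetD1 x).
rewrite not_fnd// add0n; apply: sum_ext => //.
by apply/fsetP => a; rewrite !inE; case: eqP => // ->; rewrite (negbTE xC).
Qed.

Lemma total_set C x n : (total C.[x <- n] + odflt 0 C.[? x] = total C + n)%N.
Proof.
rewrite (totalE C x) (totalE C.[x <- n] x) fnd_set eqxx/=.
rewrite [X in (n + X)%N](_ : _ =
  \sum_(a <- domf C `\ x) odflt 0%N C.[? a])%N; first lia.
apply: sum_ext => [|a].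
  by apply/fsetP => a; rewrite !inE; case: eqP.
by rewrite !inE fnd_set => /andP[/negbTE->].
Qed.

Lemma total_rem C x : (total C.[~ x] + odflt 0 C.[? x] = total C)%N.
Proof.
rewrite (totalE C x) (totalE C.[~ x] x) fnd_rem1 eqxx/= add0n addnC; congr addn.
apply: sum_ext => [|a].
  by apply/fsetP => a; rewrite !in_fsetD1 mem_remf1; case: eqP.
by rewrite !inE fnd_rem1 => /andP[/negbTE->].
Qed.

(** A free counter appears as a placeholder of count 0 and forces [n = 0]; otherwise [m] items
    contribute at least [n] each. *)
Lemma total_lower_bound m C n : (#|` domf C| <= m)%N ->
  lower_bound (slots m C) n -> (n * m <= total C)%N.
Proof.
move=> Cm low; have [Cltm|] := ltnP #|` domf C| m.
  have := low (inr 0%N) 0%N; rewrite /= add0n Cltm => /(_ erefl).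
  by rewrite leqn0 => /eqP->.
move=> mC; have -> : m = #|` domf C| by lia.
rewrite cardfE mulnC -sum_nat_const /total big_seq_fsetE/=.
by apply: leq_sum => a _; rewrite in_fnd;
  apply: (low (inl (val a))); rewrite /= in_fnd.
Qed.

Let domE C a : (a \in domf C) = C.[? a] :> bool.
Proof. by rewrite fndSome. Qed.

(** Positive counts make placeholders the only slots of count 0, positive times keep real items
    later than placeholders, and the total is bounded because each update raises it by 1. *)
Record reachable m X s C : Prop := Reachable {
  reachable_card : (#|` domf C| <= m)%N;
  reachable_pos : forall a n, C.[? a] = Some n -> (0 < n)%N;
  reachable_seen : forall a, a \in domf C -> (0 < last_time X s a)%N;
  reachable_total : (total C <= s)%N }.

Lemma reachable_inj m X s C : reachable m X s C ->
  tracked_inj (slots m C) (slot_times m X s).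
Proof.
move=> rC [a|i] [b|j] n n' /=.
- move=> /(congr1 isSome)/=; rewrite -domE => aC _ /addnI ab.
  by congr inl; apply: (last_time_inj _ ab); exact: reachable_seen rC _ _.
- move=> /(congr1 isSome)/=; rewrite -domE => aC.
  by have := reachable_seen rC aC; case: ifP => //; lia.
- move=> + /(congr1 isSome)/=; rewrite -domE => + bC.
  by have := reachable_seen rC bC; case: ifP => //; lia.
- by move=> _ _ ->.
Qed.

Lemma reachable_set m X s C x n : nth None X s = Some x ->
  (#|` x |` domf C| <= m)%N ->
  (forall a k, C.[? a] = Some k -> (0 < k)%N) ->
  (forall a, a \in domf C -> (0 < last_time X s a)%N) ->
  (0 < n)%N -> (total C + n <= s.+1 + odflt 0 C.[? x])%N ->
  reachable m X s.+1 C.[x <- n].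
Proof.
move=> Xs card pos seen n0 tot; split=> //.
- move=> a k; rewrite fnd_set; case: eqP => _; last exact: pos.
  by case=> <-.
- move=> a; rewrite last_timeS Xs mem_setf !inE.
  by case: eqVneq => //= [->|ax]; rewrite ?eqxx//; case: eqP => // _; exact: seen.
- have := total_set C x n; lia.
Qed.

(** Excludes the fallback branch of [ss_step]. *)
Lemma evicted_exists X s C : (0 < #|` domf C|)%N -> evicted X s C <> None.
Proof.
rewrite cardfE => /card_gt0P[a0 _].
rewrite /evicted; case: pickP => // none _.
have [a _ amin] := arg_minnP (P := xpredT) (fun b => C b) (i0 := a0) isT.
have aS : a \in min_items C by rewrite inE; apply/forallP => b; exact: amin.
have [/= y yS ymax] := arg_maxnP (P := mem (min_items C))
  (fun b => last_time X s (val b)) aS.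
move/negP: (none y); apply; apply/andP; split=> //.
by apply/forallP => b; apply/implyP => /ymax.
Qed.

(** Placeholders merge the three branches of the algorithm into one replacement: of the requested
    item, of a placeholder, or of the evicted item. *)
Lemma ss_step_victim m X s C x : (0 < m)%N -> nth None X s = Some x ->
  reachable m X s C -> exists y n,
  [/\ victim (slots m C) (slot_times m X s) (inl x) y n,
      slots m (ss_step m X C s) =1 replace (slots m C) y (inl x) n &
      reachable m X s.+1 (ss_step m X C s)].
Proof.
move=> m0 Xs [card pos seen tot]; rewrite /ss_step Xs.
case Cx : C.[? x] => [c|].
  have xC : x \in domf C by rewrite domE Cx.
  have xA : x |` domf C = domf C by apply/fsetUidPr; rewrite fsub1set.
  exists (inl x), c; split=> /=.
  - by split; [|left].
  - move=> [a|j]; rewrite /replace/=; last by rewrite xA.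
    rewrite fnd_set (_ : (inl a == inl x :> U + nat) = (a == x))//.
    by case: eqP.
  - apply: reachable_set => //; first by rewrite xA.
    by rewrite Cx/=; lia.
have xC : x \notin domf C by rewrite domE Cx.
have cardx : #|` x |` domf C| = #|` domf C|.+1 by rewrite cardfsU1 xC.
case: ifPn => [Cm|]; last rewrite -leqNgt => mC.
  (* The largest live placeholder index, hence the most recent slot of count 0. *)
  exists (inr (m - #|` domf C|).-1), 0%N; split=> /=.
  - split; first by rewrite /= ifT//; lia.
    right; split=> //.
    move=> [a|j] /=; first by move/pos.
    by case: ifP => // + _; lia.
  - move=> [a|j]; rewrite /replace/=.
      rewrite fnd_set (_ : (inl a == inl x :> U + nat) = (a == x))//.
    rewrite (_ : (inr j == inr _ :> U + nat) = (j == (m - #|` domf C|).-1))//.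
    rewrite cardx; case: eqP => [->|?]; first by rewrite ifF//; lia.
    by congr (if _ then _ else _); lia.
  - apply: reachable_set => //; first by rewrite cardx.
    by rewrite Cx/=; lia.
case Ey : (evicted X s C) => [y|]; last first.
  by have [] := @evicted_exists X s C; first lia.
move: Ey; rewrite /evicted; case: pickP => // y0 /andP[+ /forallP ylast] [e].
subst y0; rewrite inE => /forallP ymin.
have Cy : C.[? val y] = Some (C y) by rewrite Some_fnd.
have xy : x <> val y by move=> e; move: xC; rewrite e (valP y).
have dom_rem : domf C.[~ val y] = domf C `\ val y.
  by apply/fsetP => a; rewrite mem_remf1 !inE.
have xC' : x \notin domf C.[~ val y] by rewrite dom_rem !inE (negbTE xC) andbF.
have card' : #|` x |` domf C.[~ val y]| = #|` domf C|.
  by rewrite cardfsU1 xC' dom_rem (cardfsD1 (val y) (domf C)) (valP y).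
exists (inl (val y)), (C y); split=> /=.
- split=> //; right; split=> //.
  + move=> [a|j] b /=; last by rewrite ifF//; lia.
    move=> Ca; have aC : a \in domf C by rewrite domE Ca.
    by move: Ca; rewrite in_fnd => -[<-]; exact: ymin.
  + move=> [a|j] /=; last by rewrite ifF//; lia.
    move=> Ca; have aC : a \in domf C by rewrite domE Ca.
    rewrite leq_add2l; have /implyP := ylast [` aC]; apply.
    move: Ca; rewrite in_fnd inE => -[e]; apply/forallP => b.
    by rewrite e; exact: ymin.
- move=> [a|j]; rewrite /replace/=; last by rewrite card'.
  rewrite fnd_set fnd_rem1 (_ : (inl a == inl x :> U + nat) = (a == x))//.
  rewrite (_ : (inl a == inl (val y) :> U + nat) = (a == val y))//.
  by case: eqP => // _; case: eqP.
- apply: reachable_set => //; first by rewrite card'.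
  + by move=> a k; rewrite fnd_rem1; case: ifP => // _; exact: pos.
  + by move=> a; rewrite dom_rem !inE => /andP[_]; exact: seen.
  + have := total_rem C (val y); rewrite Cy fnd_rem1 Cx/= if_same/=; lia.
Qed.

Definition state m X s : {fmap U -> nat} :=
  foldl (ss_step m X) [fmap] (iota 0 s).

Lemma stateS m X s : state m X s.+1 = ss_step m X (state m X s) s.
Proof. by rewrite /state -addn1 iotaD foldl_cat. Qed.

Lemma ss_step_none m X C s : nth None X s = None -> ss_step m X C s = C.
Proof. by rewrite /ss_step => ->. Qed.

Lemma reachable_none m X s C : nth None X s = None ->
  reachable m X s C -> reachable m X s.+1 C.
Proof.
move=> Xs [card pos seen tot]; split=> //; last exact: leqW.
by move=> a /seen; rewrite last_timeS Xs.
Qed.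

Lemma reachable_state m X s : (0 < m)%N -> reachable m X s (state m X s).
Proof.
move=> m0; elim: s => [|s IH].
  split=> //.
    by move=> a n; rewrite fnd_fmap0.
  by rewrite /total big_seq_cond big1// => a; rewrite andbT domE fnd_fmap0.
rewrite stateS; case Xs : (nth None X s) => [x|].
  by have [y [n [_ _ r]]] := ss_step_victim m0 Xs IH.
by rewrite ss_step_none//; exact: reachable_none.
Qed.

Lemma slot_timesS m X s e : slot_times m X s.+1 e =
  if e is inl a then
    if nth None X s == Some a then (m + s.+1)%N else slot_times m X s e
  else slot_times m X s e.
Proof. by case: e => //= a; rewrite last_timeS; case: eqP. Qed.

(** * Runs on a stream and on its copy with one update removed *)

Definition agreeing (t t' : U + nat -> nat) (c c' : U + nat -> option nat) :=
  forall a n, c a = Some n -> c' a = Some n -> t a = t' a.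

Section RemovedUpdate.
Variables (X X' : stream U) (i : nat) (u : U) (m : nat).
Hypotheses (Xi : nth None X i = Some u) (X'E : X' = set_nth None X i None).
Hypothesis m_gt0 : (0 < m)%N.

Let nthX' j : nth None X' j = if j == i then None else nth None X j.
Proof. by rewrite X'E nth_set_nth. Qed.

(** The streams coincide before index [i], and [evicted] reads them only through [last_time]. *)
Lemma state_prefix s : (s <= i)%N ->
  last_time X s =1 last_time X' s /\ state m X s = state m X' s.
Proof.
elim: s => [|s IH] si; first by split=> // a; rewrite !last_time0.
have [tE cE] := IH (ltnW si).
have Xs : nth None X' s = nth None X s by rewrite nthX' ltn_eqF.
split=> [a|]; first by rewrite !last_timeS tE Xs.
rewrite !stateS cE /ss_step Xs; case: nth => // x.
rewrite (_ : evicted X s _ = evicted X' s (state m X' s))//.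
by apply: eq_pick => y /=; congr andb; apply: eq_forallb => a; rewrite !tE.
Qed.

(** The removed update leaves different times at [u], so [agreeing] is limited to equal counts: just
    after it, [u] has different counts or is absent on the side of [X'], and any later request for
    [u] makes its times equal. *)
Lemma coupled_states s : (i < s)%N ->
  coupled (slot_times m X' s) (slots m (state m X s)) (slots m (state m X' s)) /\
  agreeing (slot_times m X s) (slot_times m X' s)
    (slots m (state m X s)) (slots m (state m X' s)).
Proof.
elim: s => // s IH; rewrite ltnS leq_eqVlt => /predU1P[si|si]; last first.
  have {IH}[cpl agr] := IH si.
  have X's : nth None X' s = nth None X s by rewrite nthX' gtn_eqF.
  rewrite !stateS; case Xs : (nth None X s) => [x|]; last first.
    rewrite !ss_step_none ?X's//.
    rewrite (_ : slot_times m X s.+1 = slot_times m X s); last first.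
      by apply/funext => e; rewrite slot_timesS Xs; case: e.
    rewrite (_ : slot_times m X' s.+1 = slot_times m X' s)//.
    by apply/funext => e; rewrite slot_timesS X's Xs; case: e.
  rewrite Xs in X's.
  have [y [n [vy /funext-> _]]] :=
    ss_step_victim m_gt0 Xs (reachable_state X s m_gt0).
  have [y' [n' [vy' /funext-> _]]] :=
    ss_step_victim m_gt0 X's (reachable_state X' s m_gt0).
  split.
    apply: (coupled_step agr _ _ _ cpl vy vy').
    - exact: reachable_inj (reachable_state X s m_gt0).
    - exact: reachable_inj (reachable_state X' s m_gt0).
    - move=> [a|j] //; rewrite slot_timesS X's.
      by case: eqP => // -[->].
  move=> a k; rewrite /replace; case: eqP => [->|ax].
    by rewrite !slot_timesS Xs X's eqxx.
  case: eqP => // _; case: eqP => // _ ca c'a.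
  rewrite !slot_timesS Xs X's; have := agr a k ca c'a.
  by case: a ax {ca c'a} => // a; case: eqP => // -[->].
subst s; have [tE cE] := state_prefix (leqnn i).
have X'i : nth None X' i = None by rewrite nthX' eqxx.
rewrite !stateS -cE (ss_step_none _ _ X'i).
(* The removed update turns [(y, n)] into [(u, n.+1)] on [X], while [X'] keeps [(y, n)]: this is
   [Coupled1] with [z = u], [v = y], [l = n]. *)
have [y [n [[cy vy] /funext-> _]]] :=
  ss_step_victim m_gt0 Xi (reachable_state X i m_gt0).
split.
  apply: (@Coupled1 _ _ _ _ (inl u) n y); rewrite /replace ?eqxx//.
  - by move=> a; case: eqP; [left|case: eqP; [right; left|right; right]].
  - move=> /eqP uy; rewrite 1?eq_sym (negbTE uy) ?eqxx; split=> //; last first.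
      by case: vy uy => [->|[]//]; rewrite eqxx.
    by case: vy uy => [->|[]//]; rewrite eqxx.
move=> a k; rewrite /replace; case: eqP => [-> [<-] cu|au].
  by case: vy => [yu|[]]; rewrite ?cu//; move: cy; rewrite yu cu => -[]; lia.
move=> _ _; rewrite !slot_timesS Xi X'i.
case: a au => //= a; rewrite tE; case: eqP => // -[->]//.
Qed.

End RemovedUpdate.

(* [z] is the only item tracked on both sides whose counts may differ; it may be
   a placeholder, when the counts agree. *)
Definition close m N C C' := [/\
  (#|` domf C `\` domf C'| <= 2)%N, (#|` domf C' `\` domf C| <= 2)%N,
  (forall a n, C.[? a] = Some n -> C'.[? a] = None -> n * m <= N + m)%N,
  (forall a n, C'.[? a] = Some n -> C.[? a] = None -> n * m <= N + m)%N &
  exists z : U + nat, forall a n n', C.[? a] = Some n -> C'.[? a] = Some n' ->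
    n = n' \/ inl a = z /\ (n <= n'.+1)%N /\ (n' <= n.+1)%N].

Lemma close_sym m N C C' : close m N C C' -> close m N C' C.
Proof.
move=> [d d' b b' [z zP]]; split=> //; exists z => a n n' c c'.
by have [->|[-> []]] := zP a n' n c' c; [left|right].
Qed.

Lemma card_fsetD_le2 C C' (e f : U + nat) :
  (forall a, a \in domf C -> a \notin domf C' -> inl a = e \/ inl a = f) ->
  (#|` domf C `\` domf C'| <= 2)%N.
Proof.
move=> ef; rewrite -(size_map (inl : U -> U + nat)).
apply: (@uniq_leq_size _ _ [:: e; f]).
  by rewrite map_inj_uniq ?fset_uniq// => a b [].
move=> _ /mapP[a + ->]; rewrite in_fsetD => /andP[aC' aC].
by rewrite !inE; case: (ef a aC aC') => ->; rewrite eqxx ?orbT.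
Qed.

(** The lower bound [p] on one side gives [p * m <= N] through the total, and unmatched counts are
    at most [p.+1]. *)
Lemma coupled_slots_close m N t C C' :
  (#|` domf C| <= m)%N -> (#|` domf C'| <= m)%N ->
  (total C <= N)%N -> (total C' <= N)%N ->
  coupled t (slots m C) (slots m C') -> close m N C C'.
Proof.
move=> Cm C'm CN C'N /coupled_close[p [low [x [y xy]] [x' [y' xy']] [z zP]]].
have {low}pN : (p * m <= N)%N.
  by case: low => [/(total_lower_bound Cm)|/(total_lower_bound C'm)] /leq_trans; apply.
have bound n : (n <= p.+1)%N -> (n * m <= N + m)%N.
  by move=> np; have := leq_mul np (leqnn m); rewrite mulSn; lia.
have out A a : a \notin domf A -> slots m A (inl a) = None.
  by move=> aA; rewrite /= not_fnd.
have isin A a : a \in domf A -> exists n, slots m A (inl a) = Some n.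
  by rewrite domE/=; case: fnd => // n _; exists n.
split.
- apply: (@card_fsetD_le2 _ _ x y) => a /isin[n ca] /out c'a.
  by have [] := xy (inl a) n ca c'a.
- apply: (@card_fsetD_le2 _ _ x' y') => a /isin[n ca] /out c'a.
  by have [] := xy' (inl a) n ca c'a.
- by move=> a n ca c'a; apply: bound; have [] := xy (inl a) n ca c'a.
- by move=> a n ca c'a; apply: bound; have [] := xy' (inl a) n ca c'a.
- by exists z => a n n' ca c'a; exact: (zP (inl a)) ca c'a.
Qed.

Lemma removal_size X X' : removal X X' -> size X' = size X.
Proof.
move=> [i [u [Xi ->]]]; rewrite size_set_nth; apply/maxn_idPr.
by rewrite ltnNge; apply/negP => /(nth_default None); rewrite Xi.
Qed.

Lemma neighboring_size X X' : neighboring X X' -> size X' = size X.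
Proof. by case=> /removal_size. Qed.

Lemma ss_close X X' m : (0 < m)%N -> neighboring X X' ->
  close m (size X) (ss X m) (ss X' m).
Proof.
have main Y Y' : (0 < m)%N -> removal Y Y' -> close m (size Y) (ss Y m) (ss Y' m).
  move=> m0 YY'; have sY := removal_size YY'; case: YY' => i [u [Yi Y'E]].
  have iY : (i < size Y)%N.
    by rewrite ltnNge; apply/negP => /(nth_default None); rewrite Yi.
  have [cpl _] := coupled_states Yi Y'E m0 iY.
  have r := reachable_state Y (size Y) m0.
  have r' := reachable_state Y' (size Y) m0.
  have -> : ss Y' m = state m Y' (size Y) by rewrite /ss sY.
  apply: coupled_slots_close cpl; by [apply: reachable_card r |
    apply: reachable_card r' | apply: reachable_total r | apply: reachable_total r'].
move=> m0 [XX'|XX']; first exact: main.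
by apply: close_sym; rewrite (removal_size XX'); exact: main.
Qed.

End SpaceSavingRun.

(** * Laplace noise *)

Import Order.TTheory GRing.Theory Num.Theory.
Import numFieldNormedType.Exports.

Local Open Scope classical_set_scope.
Local Open Scope ring_scope.

Section Laplace.
Context {R : realType}.
Implicit Types (b d g : R).
Notation mu := (@lebesgue_measure R).

Definition translate d (x : R) : measurableTypeR R := x + d.

Let measurable_translate d : measurable_fun [set: R] (translate d).
Proof. by apply: measurable_funD => //; exact: measurable_cst. Qed.

(** Lebesgue measure is determined by its values on half-open intervals, whose length a translation
    preserves. *)
Lemma lebesgue_measure_shift d (A : set R) : measurable A ->
  pushforward mu (translate d) A = mu A.
Proof.
move=> mA; apply/esym; apply: lebesgue_measure_unique => //=.
  exact: measurable_translate.
move=> mt _ [[p q]] _ <-.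
rewrite /pushforward (_ : _ @^-1` _ = `]p - d, q - d]%classic).
  rewrite !lebesgue_measure_itv/= !lte_fin ltrD2r; case: ifP => // _.
  by rewrite -!EFinD; congr EFin; ring.
by apply/seteqP; split => x /=; rewrite /translate !in_itv/= ltrBlDr lerBrDr.
Qed.

(** A change of variables moves the shift into the density, which by the triangle inequality grows
    by a factor of at most [expR b^-1]. *)
Lemma laplace_prob_shift b d (W : set R) : 0 < b -> `|d| <= 1 -> measurable W ->
  (laplace_prob b ((fun x => (x + d)%R) @^-1` W) <=
   (expR b^-1)%:E * laplace_prob b W)%E.
Proof.
move=> b0 d1 mW; rewrite /laplace_prob.
have mf e : measurable_fun W (fun x => (laplace_pdf b (x + e))%:E).
  apply/measurable_EFinP/measurable_funTS.
  exact: (measurableT_comp (measurable_laplace_pdf b) (measurable_translate e)).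
have mf0 : measurable_fun W (fun x => (laplace_pdf b x)%:E).
  by apply/measurable_EFinP/measurable_funTS; exact: measurable_laplace_pdf.
have -> : (\int[mu]_(x in (fun x => (x + d)%R) @^-1` W) (laplace_pdf b x)%:E =
    \int[mu]_(x in W) (laplace_pdf b (x - d)%R)%:E)%E.
  transitivity (\int[pushforward mu (translate d)]_(x in W)
      (laplace_pdf b (x - d)%R)%:E)%E.
    have := @ge0_integral_pushforward _ _ (measurableTypeR R)
      (measurableTypeR R) R (translate d) (measurable_translate d)
      (@lebesgue_measure R) W (fun x => (laplace_pdf b (x - d)%R)%:E) mW (mf (- d)).
    move=> ->; last by move=> x _; rewrite lee_fin laplace_pdf_ge0.
    by apply: eq_integral => x _ /=; rewrite /translate addrK.
  apply: eq_measure_integral => [|mt A mA _]; first exact: measurable_translate.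
  exact: lebesgue_measure_shift.
rewrite -ge0_integralZl//; last first.
  by move=> x _; rewrite lee_fin laplace_pdf_ge0.
apply: ge0_le_integral => //.
- by move=> x _; rewrite lee_fin laplace_pdf_ge0.
- exact: mf (- d).
- by apply: emeasurable_funM => //; exact: measurable_cst.
move=> x _; rewrite -EFinM lee_fin /laplace_pdf b0 mulrCA.
rewrite ler_pM2l ?invr_gt0 ?mulr_gt0// -expRD ler_expR.
have k0 : 0 < b^-1 by rewrite invr_gt0.
have := ler_normD (x - d) d; rewrite subrK; nra.
Qed.

(** On the positive half-line the density is half an exponential density, which has an explicit
    antiderivative. *)
Lemma laplace_prob_tail b g : 0 < b -> 0 <= g ->
  laplace_prob b `[g, +oo[ = (2^-1 * expR (- (g / b)))%:E.
Proof.
move=> b0 g0; rewrite /laplace_prob.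
have bV0 : 0 < b^-1 by rewrite invr_gt0.
under eq_integral => x.
  rewrite inE/= in_itv/= andbT => gx; have x0 := le_trans g0 gx.
  rewrite (_ : laplace_pdf b x = 2^-1 * exponential_pdf b^-1 x); last first.
    rewrite exponential_pdfE// /laplace_pdf b0 ger0_norm// invfM mulrA.
    by congr (_ * expR _); rewrite mulNr mulrC.
  rewrite EFinM; over.
rewrite ge0_integralZl//=; last 2 first.
- apply/measurable_EFinP; apply: measurable_funTS.
  exact: measurable_exponential_pdf.
- by move=> x _; rewrite lee_fin exponential_pdf_ge0// ltW.
have cexp : continuous (fun z : R^o => expR (- b^-1 * z)).
  move=> z; apply: continuous_comp; last exact: continuous_expR.
  by apply: continuousM => //; apply: (@continuousN _ R^o); exact: cst_continuous.
rewrite (@ge0_continuous_FTC2y _ _ (fun x => - expR (- b^-1 * x)) _ 0)//.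
- by rewrite sub0e -EFinN opprK -EFinM mulNr [b^-1 * _]mulrC.
- by move=> x _; rewrite exponential_pdf_ge0// ltW.
- apply: (@continuous_subspaceW R^o _ _ [set` `[0, +oo[%R]).
    by apply: subset_itvr; rewrite bnd_simp.
  exact: within_continuous_exponential_pdf.
- rewrite -oppr0; apply: cvgN.
  rewrite (_ : (fun x => expR (- b^-1 * x)) =
               (fun z => expR (- z)) \o (fun z => b^-1 * z)); last first.
    by apply: eq_fun => x; rewrite mulNr.
  apply: (@cvg_comp _ _ _ _ _ _ (pinfty_nbhs R)); last exact: cvgr_expR.
  exact: gt0_cvgMry.
- by apply: cvgN; apply/cvg_at_right_filter; exact: cexp.
- move=> x; rewrite in_itv/= andbT => gx; apply: derive1_exponential_pdf.
  by rewrite in_itv/= andbT (le_lt_trans g0 gx).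
Qed.
End Laplace.

(** * Independent draws *)

Section IIDReindexing.
Context {d} {T : measurableType d} {R : realType} (P : probability T R).

Definition box n (A : 'I_n -> set T) : set (n.-tuple T) :=
  [set v | forall i, A i (tnth v i)].

Lemma box_setT n : box (fun _ : 'I_n => [set: T]) = setT.
Proof. exact/seteqP. Qed.

Lemma measurable_box n (A : 'I_n -> set T) :
  (forall i, measurable (A i)) -> measurable (box A).
Proof.
move=> mA; rewrite (_ : box A =
    \bigcap_(i in [set: 'I_n]) ((@tnth n T)^~ i @^-1` A i)).
  apply: fin_bigcap_measurable => [|i _]; first exact: finite_finset.
  by rewrite -[X in measurable X]setTI; exact: measurable_tnth.
by apply/seteqP; split=> v Av i; [move=> _; exact: Av|exact: Av i Logic.I].
Qed.

(** Boxes are stable under intersection, so this allows the uniqueness theorem for measures to be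
    applied to them. *)
Lemma measurable_tupleE n : @measurable _ (n.-tuple T) =
  <<s [set box A | A in [set A : 'I_n -> set T | forall i, measurable (A i)]] >>.
Proof.
apply/seteqP; split; last first.
  apply: smallest_sub; first exact: sigma_algebra_measurable.
  by move=> _ [A mA <-]; exact: measurable_box.
apply: smallest_sub; first exact: smallest_sigma_algebra.
move=> B; rewrite -bigcup_seq => -[i _ [A mA <-]]; apply: sub_sigma_algebra.
exists (fun j => if j == i then A else setT).
  by move=> j; case: ifP.
rewrite setTI; apply/seteqP; split=> v; first by move=> /(_ i)/=; rewrite eqxx.
by move=> Av j; case: eqP => // ->.
Qed.

Lemma iid_box n (A : 'I_n -> set T) : (forall i, measurable (A i)) ->
  iid P n (box A) = (\prod_(i < n) P (A i))%E.
Proof.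
elim: n A => [|n IH] A mA.
  rewrite big_ord0 /= diracE mem_set//; case => //.
rewrite big_ord_recl -IH//=.
rewrite -product_measure1E//; last exact: measurable_box.
congr ((_ \x _)%E _); apply/seteqP; split=> -[x v] /=.
  move=> Av; split; first exact: (Av ord0).
  by move=> i; have := Av (lift ord0 i); rewrite /Defs.cons_tuple/= tnthS.
move=> [Ax Av] i; case: (unliftP ord0 i) => [j ->|->]; last by [].
by rewrite /Defs.cons_tuple tnthS; exact: Av.
Qed.

Definition reindex_tuple n n' (f : 'I_n -> 'I_n') (v : n'.-tuple T) : n.-tuple T :=
  [tuple tnth v (f i) | i < n].

Lemma measurable_reindex_tuple n n' (f : 'I_n -> 'I_n') :
  measurable_fun setT (reindex_tuple f).
Proof.
apply/measurable_fun_tnthP => i.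
rewrite (_ : _ \o _ = (@tnth _ T)^~ (f i)); first exact: measurable_tnth.
by apply/funext => v /=; rewrite tnth_mktuple.
Qed.

HB.instance Definition _ n n' (f : 'I_n -> 'I_n') :=
  @isMeasurableFun.Build _ _ _ _ (reindex_tuple f) (@measurable_reindex_tuple n n' f).

(** Both laws give a box the same product up to the order of factors. Two sizes [n] and [n'] appear
    because the lemma serves [#|{: S}|] and [#|{: S'}|.+1], which are equal but not convertible. *)
Lemma iid_reindex n n' (f : 'I_n -> 'I_n') B : bijective f -> measurable B ->
  iid P n' (reindex_tuple f @^-1` B) = iid P n B.
Proof.
move=> [g fK gK] mB; symmetry.
apply: (measure_unique _ (fun=> setT) (@measurable_tupleE n) _ _ _
  (iid P n) (distribution (iid P n') (reindex_tuple f))) => //.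
- move=> _ _ [A mA <-] [A' mA' <-]; exists (fun i => A i `&` A' i).
    by move=> i; exact: measurableI.
  apply/seteqP; split=> v; first by move=> AA; split=> i; have [] := AA i.
  by move=> [Av A'v] i; split; [exact: Av|exact: A'v].
- by move=> _; exists (fun=> setT) => //; exact: box_setT.
- by rewrite bigcup_const//; exists 0%N.
- move=> _ [A mA <-]; transitivity (\prod_(i < n) P (A i))%E; first exact: iid_box.
  transitivity (iid P n' (box (A \o g))).
    rewrite (iid_box (A := A \o g)); last by move=> i; exact: mA.
    by rewrite [RHS](reindex f)/=; [apply: eq_bigr => i _; rewrite fK|exists g => i _].
  congr (iid P n' _); apply/seteqP; split=> v /= Av i.
    by have := Av (f i); rewrite tnth_mktuple/= fK.
  by have := Av (g i); rewrite tnth_mktuple gK.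
- by move=> _; exact: le_lt_trans (probability_le1 (iid P n) measurableT) (ltry _).
Qed.

End IIDReindexing.

(** * The law of the released counts *)

Section OutputLaw.
Context {U : choiceType} {R : realType}.
Variables (P : probability R R) (tau : R).
Implicit Types (S : {fset U}) (h : U -> nat).

(** Separating the tracked set from a count function on all of [U] lets items be dropped while [h]
    stays fixed. *)
Definition counts S h : {fmap U -> nat} := [fmap x : S => h (val x)].

Definition output S h : #|{: S}|.-tuple R -> {fmap U -> R} :=
  @dpss_output U R tau (counts S h).
Arguments output : clear implicits.

Definition law S h (Z : set {fmap U -> R}) : \bar R :=
  iid P #|{: S}| (output S h @^-1` Z).

Definition threshold (v : R) : option R := if tau < v then Some v else None.

Lemma fnd_output_in S h eta u (uS : u \in S) :
  (output S h eta).[? u] = threshold ((h u)%:R + tnth eta (enum_rank [` uS])).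
Proof.
rewrite /output /dpss_output /release fnd_restrict.
have cu : (@noisy_counts U R (counts S h) eta).[? u] =
    Some ((h u)%:R + tnth eta (enum_rank [` uS])).
  by rewrite (in_fnd (f := noisy_counts eta) uS) !ffunE.
rewrite cu /threshold; congr (if _ then _ else _).
apply/imfsetP/idP => [[/= x + ux]|tu].
  rewrite !unfold_in /= !ffunE; subst u.
  by rewrite (_ : [` uS] = x)//; exact: val_inj.
by exists [` uS] => //; rewrite unfold_in /= !ffunE.
Qed.

Lemma fnd_output_notin S h eta u : u \notin S -> (output S h eta).[? u] = None.
Proof.
move=> uS; rewrite /output /dpss_output /release fnd_restrict.
case: ifP => // _; rewrite not_fnd//.
Qed.

Lemma measurable_output S h Z : measurable Z -> measurable (output S h @^-1` Z).
Proof.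
move=> mZ; rewrite -[X in measurable X]setTI.
exact: (@measurable_dpss_output U R tau (counts S h)).
Qed.

(** * Isolating the noise of one item *)

Section Coordinate.
Variables (S : {fset U}) (x : U).
Hypothesis xS : x \in S.
Local Notation S' := (S `\ x)%fset.

(** Puts [x] in front and numbers the other items by their rank in [S'], so that the noise of [x]
    becomes the first factor of a product. *)
Definition coord_index (i : 'I_#|{: S}|) : 'I_#|{: S'}|.+1 :=
  if insub (val (enum_val i)) is Some y then lift ord0 (enum_rank (y : S'))
  else ord0.

Lemma coord_index_bij : bijective coord_index.
Proof.
apply: inj_card_bij; last first.
  by rewrite !card_ord -!cardfE (cardfsD1 x S) xS.
have outside (i : 'I_#|{: S}|) : val (enum_val i) \notin S' -> val (enum_val i) = x.
  by rewrite !inE fsvalP andbT negbK => /eqP.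
move=> i j; rewrite /coord_index.
case: insubP => [y _ yi|/outside ix]; case: insubP => [y' _ yj|/outside jx] //.
- move=> /lift_inj/enum_rank_inj yy'; apply: enum_val_inj; apply: val_inj.
  by rewrite -yi -yj yy'.
- by move=> _; apply: enum_val_inj; apply: val_inj; rewrite ix jx.
Qed.

Definition with_coord (p : R * #|{: S'}|.-tuple R) : #|{: S}|.-tuple R :=
  reindex_tuple coord_index (Defs.cons_tuple p).

Lemma law_with_coord h Z : measurable Z -> law S h Z =
  (P \x iid P #|{: S'}|)%E ((output S h \o with_coord) @^-1` Z).
Proof.
move=> mZ; rewrite /law.
by rewrite -(iid_reindex P coord_index_bij (@measurable_output S h Z mZ)).
Qed.

Lemma measurable_with_coord h Z : measurable Z ->
  measurable ((output S h \o with_coord) @^-1` Z).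
Proof.
move=> mZ; rewrite comp_preimage -[X in measurable X]setTI.
apply: (measurableT_comp (@measurable_reindex_tuple _ _ _ _ coord_index)
  (@measurable_cons_tuple _ R _)) => //.
exact: measurable_output.
Qed.

Lemma tnth_with_coord_in p (y : S) (y' : S') : val y' = val y ->
  tnth (with_coord p) (enum_rank y) = tnth p.2 (enum_rank y').
Proof.
move=> yy'; rewrite tnth_mktuple /coord_index enum_rankK -yy' valK.
by rewrite tnthS.
Qed.

Lemma tnth_with_coord_out p (y : S) : val y = x ->
  tnth (with_coord p) (enum_rank y) = p.1.
Proof.
move=> yx; rewrite tnth_mktuple /coord_index enum_rankK yx insubF//.
by rewrite !inE eqxx.
Qed.

Lemma output_low h eta r : (h x)%:R + eta <= tau ->
  output S h (with_coord (eta, r)) = output S' h r.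
Proof.
move=> low; apply/fmapP => u.
have [uS'|uS'] := boolP (u \in S').
  have uS : u \in S by move: uS'; rewrite !inE => /andP[].
  by rewrite !fnd_output_in (@tnth_with_coord_in _ [` uS] [` uS']).
rewrite (fnd_output_notin _ _ uS').
have [uS|uS] := boolP (u \in S); last by rewrite fnd_output_notin.
have ux : u = x by move: uS'; rewrite !inE uS andbT negbK => /eqP.
subst u; rewrite fnd_output_in tnth_with_coord_out//=.
by rewrite /threshold ltNge low.
Qed.

Lemma output_shift h h' eta eta' r :
  (forall u, u \in S' -> h u = h' u) ->
  (h x)%:R + eta = (h' x)%:R + eta' ->
  output S h (with_coord (eta, r)) = output S h' (with_coord (eta', r)).
Proof.
move=> hh' xx'; apply/fmapP => u.
have [uS|uS] := boolP (u \in S); last by rewrite !fnd_output_notin.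
rewrite !fnd_output_in; congr threshold.
have [ux|ux] := eqVneq u x.
  by rewrite !tnth_with_coord_out//= ux.
have uS' : u \in S' by rewrite !inE ux.
by rewrite !(@tnth_with_coord_in _ [` uS] [` uS'])//= hh'.
Qed.


Lemma measurable_high h : measurable [set eta | tau < (h x)%:R + eta].
Proof.
rewrite (_ : mkset _ = `]tau - (h x)%:R, +oo[%classic)//.
by apply/seteqP; split => eta /=; rewrite in_itv/= andbT ltrBlDl.
Qed.

(** A union bound: either [x] passes the threshold, or the output is the one computed without
    [x]. *)
Lemma law_le_remove h Z : measurable Z ->
  (law S h Z <= P [set eta | (tau < (h x)%:R + eta)%R] + law S' h Z)%E.
Proof.
move=> mZ; rewrite law_with_coord//.
have mhigh := measurable_high h.
have mA : measurable ([set eta | tau < (h x)%:R + eta] `*` setT :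
    set (R * #|{: S'}|.-tuple R)) by exact: measurableX.
have mB : measurable ([set: R] `*` (output S' h @^-1` Z)).
  by apply: measurableX => //; exact: measurable_output.
apply: (@le_trans _ _ ((P \x iid P #|{: S'}|)%E
  ([set eta | tau < (h x)%:R + eta] `*` setT `|` setT `*` (output S' h @^-1` Z)))).
  apply: le_measure; rewrite ?inE; [exact: measurable_with_coord|exact: measurableU|].
  move=> [eta r] /= ZO; have [low|high] := leP ((h x)%:R + eta) tau; last by left.
  by right; split=> //=; rewrite -(@output_low h eta r low).
have : ((P \x iid P #|{: S'}|)
    ([set eta | (tau < (h x)%:R + eta)%R] `*` setT `|` setT `*` (output S' h @^-1` Z)) <=
    (P \x iid P #|{: S'}|) ([set eta | (tau < (h x)%:R + eta)%R] `*` setT) +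
    (P \x iid P #|{: S'}|) (setT `*` (output S' h @^-1` Z)))%E.
  exact: measureU2.
rewrite !product_measure1E//; last exact: measurable_output.
rewrite [X in (_ + X * _)%E](_ : _ = 1%E); last exact: (probability_setT P).
rewrite [X in (_ * X + _)%E](_ : _ = 1%E); last exact: (probability_setT (iid P _)).
by rewrite mule1 mul1e.
Qed.

(** The noise of [x] is independent of the rest, and when it is low the output is the one computed
    without [x]. *)
Lemma law_ge_remove h Z : measurable Z ->
  (P [set eta | ((h x)%:R + eta <= tau)%R] * law S' h Z <= law S h Z)%E.
Proof.
move=> mZ; rewrite law_with_coord//.
have mlow : measurable [set eta | (h x)%:R + eta <= tau].
  rewrite (_ : mkset _ = ~` [set eta | tau < (h x)%:R + eta]).
    by apply: measurableC; exact: measurable_high.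
  by apply/seteqP; split => eta /=; rewrite leNgt => /negP.
rewrite -product_measure1E//; last exact: measurable_output.
apply: le_measure; rewrite ?inE; [|exact: measurable_with_coord|].
  by apply: measurableX => //; exact: measurable_output.
by move=> [eta r] [/= low ZO]; rewrite output_low.
Qed.

Lemma law_shift h h' (c : R) Z : measurable Z -> 0 <= c ->
  (forall W : set R, measurable W ->
    (P ((fun eta => (eta + ((h x)%:R - (h' x)%:R))%R) @^-1` W) <= c%:E * P W)%E) ->
  (forall u, u \in S' -> h u = h' u) ->
  (law S h Z <= c%:E * law S h' Z)%E.
Proof.
move=> mZ c0 cP hh'; rewrite !law_with_coord//.
pose B g := (output S g \o with_coord) @^-1` Z.
have mB g : measurable (B g) by exact: measurable_with_coord.
(* Fubini, in the order that puts the noise of [x] inside. *)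
have swap g : (P \x iid P #|{: S'}|)%E (B g) =
    (\int[iid P #|{: S'}|]_r P (ysection (B g) r))%E.
  transitivity ((P \x^ iid P #|{: S'}|)%E (B g)) => //.
  by apply: product_measure_unique => // A1 A2 *; exact: product_measure2E.
rewrite -/(B h) -/(B h') !swap -ge0_integralZl//; last exact: measurable_fun_ysection.
apply: ge0_le_integral => //.
- exact: measurable_fun_ysection.
- by apply: emeasurable_funM => //; exact: measurable_fun_ysection.
move=> r _; apply: le_trans (cP _ (measurable_ysection r (mB h'))).
rewrite (_ : _ @^-1` _ = ysection (B h) r)//.
apply/seteqP; split=> eta; rewrite /ysection/= !inE /B/=.
  by rewrite (@output_shift h h' eta (eta + ((h x)%:R - (h' x)%:R)))//; ring.
by rewrite (@output_shift h h' eta (eta + ((h x)%:R - (h' x)%:R)))//; ring.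
Qed.

End Coordinate.

End OutputLaw.

(** * Dropping a set of items unlikely to be released *)

Section Removal.
Context {U : choiceType} {R : realType}.
Variables (P : probability R R) (tau : R) (h : U -> nat) (Z : set {fmap U -> R}).
Hypothesis mZ : measurable Z.
Implicit Types S D : {fset U}.

Definition release_prob S : R := fine (law P tau S h Z).

Lemma lawE S : law P tau S h Z = (release_prob S)%:E.
Proof.
rewrite /release_prob fineK//; apply: fin_num_measure.
exact: measurable_output.
Qed.

Lemma release_prob_ge0 S : 0 <= release_prob S.
Proof. by rewrite -lee_fin -lawE. Qed.

Lemma release_prob_le1 S : release_prob S <= 1.
Proof. by rewrite -lee_fin -lawE; apply: probability_le1; exact: measurable_output. Qed.

(** Items of [D] are dropped one at a time. The lower bound is multiplicative, as [privacy_loss_add]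
    requires. *)
Lemma release_prob_remove kappa S D : 0 <= kappa <= 1 -> (D `<=` S)%fset ->
  (forall x, x \in D -> P [set eta | (tau < (h x)%:R + eta)%R] <= kappa%:E)%E ->
  release_prob S <= release_prob (S `\` D)%fset + kappa *+ #|` D| /\
  (1 - kappa *+ #|` D|) * release_prob (S `\` D)%fset <= release_prob S.
Proof.
move=> /andP[k0 k1]; move En : #|` D| => n.
elim: n S D En => [|n IH] S D En DS Dk.
  by move/cardfs0_eq: En => ->; rewrite fsetD0 mulr0n addr0 subr0 mul1r.
have /fset0Pn[x xD] : D != fset0 by rewrite -cardfs_gt0 En.
have xS : x \in S by exact: (fsubsetP DS).
have cardD : #|` (D `\ x)%fset| = n by move: En; rewrite (cardfsD1 x) xD => -[].
have -> : (S `\` D = (S `\ x) `\` (D `\ x))%fset.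
  apply/fsetP => u; rewrite !inE.
  by have [->|] := eqVneq u x; rewrite ?xD ?andbF//=.
have [] := IH (S `\ x)%fset (D `\ x)%fset cardD.
- exact: fsetSD.
- by move=> y; rewrite !inE => /andP[_]; exact: Dk.
have := release_prob_ge0 ((S `\ x) `\` (D `\ x))%fset.
set r := release_prob ((S `\ x) `\` (D `\ x))%fset => r0 le1 ge1.
have up : release_prob S <= kappa + release_prob (S `\ x)%fset.
  rewrite -lee_fin EFinD -!lawE; apply: le_trans (law_le_remove P tau xS h mZ) _.
  by rewrite leeD2r// Dk.
have down : (1 - kappa) * release_prob (S `\ x)%fset <= release_prob S.
  rewrite -lee_fin EFinM -!lawE; apply: le_trans (law_ge_remove P tau xS h mZ).
  apply: lee_wpmul2r => //.
  rewrite (_ : [set eta | _] = ~` [set eta | (tau < (h x)%:R + eta)%R]).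
    rewrite probability_setC; last exact: measurable_high.
    by rewrite EFinB leeB// Dk.
  by apply/seteqP; split => eta /=; rewrite leNgt => /negP.
rewrite mulrSr; have kn : 0 <= kappa *+ n by rewrite mulrn_wge0.
split; first by lra.
(* The cross term discarded from [(1 - kappa) * (1 - kappa *+ n) * r]. *)
by have : 0 <= kappa * (kappa *+ n) * r by [rewrite !mulr_ge0]; nra.
Qed.

End Removal.

(** * Comparing the output laws of two close states *)

Section OutputPrivacy.
Context {U : choiceType} {R : realType}.
Implicit Types (C : {fmap U -> nat}) (S : {fset U}).

Definition count_in C (u : U) : nat := odflt 0%N C.[? u].

Lemma counts_count_in C : counts (domf C) (count_in C) = C.
Proof.
apply/fmapP => u; have [uC|uC] := boolP (u \in domf C); last by rewrite !not_fnd.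
rewrite (in_fnd (f := counts _ _) uC) (in_fnd (f := C) uC) ffunE /count_in/=.
by rewrite (in_fnd (f := C) uC).
Qed.

Lemma dpss_law (P : probability R R) tau C (Z : set {fmap U -> R}) :
  iid P #|{: domf C}| (@dpss_output U R tau C @^-1` Z) =
  law P tau (domf C) (count_in C) Z.
Proof.
(* The tuple type depends on the map, so the equality is transported through a function of the whole
   map. *)
pose F C0 := iid P #|{: domf C0}| (@dpss_output U R tau C0 @^-1` Z).
exact: (congr1 F (esym (counts_count_in C))).
Qed.

Lemma law_ext (P : probability R R) tau S h h' Z : {in S, h =1 h'} ->
  law P tau S h Z = law P tau S h' Z.
Proof.
move=> hh'; rewrite /law (_ : @output U R tau S h = @output U R tau S h')//.
apply/funext => eta; apply/fmapP => u.
have [uS|uS] := boolP (u \in S); last by rewrite !fnd_output_notin.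
by rewrite !fnd_output_in hh'.
Qed.

(** Passing [tau] requires noise of at least [g], and [expR (- (eps * g))] equals [delta / 2]; the
    factor one half of the tail gives [delta / 4]. *)
Lemma laplace_prob_above eps delta tau (c : R) : 0 < eps -> 0 < delta < 1 ->
  c + eps^-1 * ln (2 / delta) <= tau ->
  (laplace_prob eps^-1 [set eta | (tau < c + eta)%R] <= (delta / 4)%:E)%E.
Proof.
move=> e0 /andP[d0 d1] ctau; set g := eps^-1 * _ in ctau.
have d21 : 1 <= 2 / delta by rewrite ler_pdivlMr//; lra.
have g0 : 0 <= g by rewrite mulr_ge0 ?invr_ge0 ?ln_ge0// ltW.
have eV0 : 0 < eps^-1 by rewrite invr_gt0.
apply: (@le_trans _ _ (laplace_prob eps^-1 `[g, +oo[)); last first.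
  rewrite laplace_prob_tail// lee_fin /g invrK mulrAC mulVf ?gt_eqF// mul1r.
  rewrite -lnV ?posrE ?divr_gt0// lnK ?posrE ?invr_gt0 ?divr_gt0// invf_div.
  by lra.
apply: le_measure; rewrite ?inE//.
  rewrite (_ : mkset _ = `]tau - c, +oo[%classic)//.
  by apply/seteqP; split => eta /=; rewrite in_itv/= andbT ltrBlDl.
by move=> eta /=; rewrite in_itv/= andbT; lra.
Qed.

Lemma count_bound m N n gamma (k : R) : (0 < m)%N -> (n * m <= N + m)%N ->
  n%:R + gamma <= Num.max k (N%:R / m%:R + 1 + gamma).
Proof.
move=> m0 nN; rewrite le_max; apply/orP; right; rewrite lerD2r.
have m0' : 0 < m%:R :> R by rewrite ltr0n.
rewrite -(ler_pM2r m0') mulrDl mul1r divfK ?gt_eqF//.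
by rewrite -natrM -natrD ler_nat.
Qed.

(** If [z] is an item of [S], one coordinate shifts by at most 1; otherwise the laws coincide and
    [expR eps] is at least 1. *)
Lemma common_law_le eps tau S h h' (z : U + nat) (Z : set {fmap U -> R}) :
  0 < eps -> measurable Z ->
  (forall u, u \in S -> h u = h' u \/
     inl u = z /\ (h u <= (h' u).+1)%N /\ (h' u <= (h u).+1)%N) ->
  (law (laplace_prob eps^-1) tau S h Z <=
   (expR eps)%:E * law (laplace_prob eps^-1) tau S h' Z)%E.
Proof.
move=> e0 mZ hh'.
have [[x [xS zx]]|nox] := pselect (exists x, x \in S /\ inl x = z).
  apply: (@law_shift U R _ tau S x xS) => //.
    move=> W mW; rewrite -[in expR _](invrK eps).
    apply: laplace_prob_shift => //; first by rewrite invr_gt0.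
    have [->|[_ [le1 le2]]] := hh' x xS; first by rewrite subrr normr0.
    rewrite ler_norml; move: le1 le2; rewrite -!(ler_nat R) -!natr1; lra.
  move=> u; rewrite !inE => /andP[ux uS].
  by have [//|[uz _]] := hh' u uS; move: uz ux; rewrite -zx => -[->]; rewrite eqxx.
rewrite (@law_ext _ tau S h h'); last first.
  by move=> u uS; have [//|[uz _]] := hh' u uS; case: nox; exists u.
rewrite lawE// -EFinM lee_fin ler_peMl ?release_prob_ge0//.
by rewrite -expR0 ler_expR ltW.
Qed.

Lemma quarter_le1 (delta : R) : 0 < delta < 1 -> 0 <= delta / 4 <= 1.
Proof. by move=> /andP[d0 d1]; apply/andP; split; lra. Qed.

Lemma quarter_mulrn_le (delta : R) n : 0 <= delta -> (n <= 2)%N ->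
  delta / 4 *+ n <= delta / 2.
Proof.
move=> d0 n2; apply: (@le_trans _ _ (delta / 4 *+ 2)); last by rewrite mulr2n; lra.
by apply: ler_wpMn2l => //; lra.
Qed.

(* The failure probability [y] on the side of [p'] enters as a factor [1 - y], so
   it is not amplified by [e]. *)
Lemma privacy_loss_add (e delta p a a' p' x y : R) :
  0 < e -> 0 <= delta < 1 -> 0 <= a <= 1 ->
  p <= a + x -> a <= e * a' -> (1 - y) * a' <= p' ->
  x <= delta / 2 -> y <= delta / 2 -> p <= e * p' + delta.
Proof.
move=> e0 /andP[d0 d1] /andP[a0 a1] pa aa' a'p' xd yd.
have ep' : e * ((1 - y) * a') <= e * p' by rewrite ler_pM2l.
have ya : (1 - y) * a <= (1 - y) * (e * a') by apply: ler_wpM2l => //; lra.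
(* In [a = (1 - y) * a + y * a], the first term is at most [e * p']; the second costs [delta / 2]
   because [a <= 1]. *)
have y0 : y * a <= delta / 2 by nra.
have : e * ((1 - y) * a') = (1 - y) * (e * a') by ring.
lra.
Qed.

(** The comparison passes through the common items: items of [C] alone are dropped, the common
    counts are exchanged, and items of [C'] alone are restored. *)
Lemma close_laws_le eps delta k m N C C' (Z : set {fmap U -> R}) :
  let tau := Num.max k (N%:R / m%:R + 1 + eps^-1 * ln (2 / delta)) in
  0 < eps -> 0 < delta < 1 -> (0 < m)%N -> measurable Z -> close m N C C' ->
  (law (laplace_prob eps^-1) tau (domf C) (count_in C) Z <=
   (expR eps)%:E * law (laplace_prob eps^-1) tau (domf C') (count_in C') Z +
   delta%:E)%E.
Proof.
move=> tau e0 d01 m0 mZ [cD cD' bD bD' [z zP]].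
have /andP[d0 d1] := d01.
have bound (A A' : {fmap U -> nat}) : 
      (forall a n, A.[? a] = Some n -> A'.[? a] = None ->
      n * m <= N + m)%N ->
    forall x, x \in (domf A `\` domf A')%fset ->
    (laplace_prob eps^-1 [set eta | (tau < (count_in A x)%:R + eta)%R] <= (delta / 4)%:E)%E.
  move=> b x; rewrite in_fsetD => /andP[xA' xA].
  apply: laplace_prob_above => //; apply: count_bound => //.
  have Ax := in_fnd (f := A) xA.
  by rewrite /count_in Ax; apply: (b x _ Ax); exact: not_fnd.
have k01 := quarter_le1 d01.
have [le1 _] := release_prob_remove (P := laplace_prob eps^-1)
  (tau := tau) (h := count_in C)
  mZ k01 (fsubsetDl _ _) (bound C C' bD).
have [_ ge1] := release_prob_remove (P := laplace_prob eps^-1)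
  (tau := tau) (h := count_in C')
  mZ k01 (fsubsetDl _ _) (bound C' C bD').
(* Removing [C] minus [C'] from [C] leaves the intersection, and likewise for [C'], so both bounds
   refer to the same set. *)
rewrite !fsetDDr !fsetDv !fset0U in le1 ge1.
rewrite fsetIC in ge1.
have prem u : u \in (domf C `&` domf C')%fset ->
    count_in C u = count_in C' u \/ inl u = z /\
    (count_in C u <= (count_in C' u).+1)%N /\
    (count_in C' u <= (count_in C u).+1)%N.
  rewrite in_fsetI => /andP[uC uC'].
  have Cu := in_fnd (f := C) uC; have C'u := in_fnd (f := C') uC'.
  by rewrite /count_in Cu C'u; exact: (zP u).
have := common_law_le (eps := eps) tau e0 mZ prem.
rewrite !(lawE _ _ _ mZ) -!EFinM -EFinD !lee_fin => common.
have a0 := release_prob_ge0 (laplace_prob eps^-1) tau (count_in C) mZ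
  (domf C `&` domf C')%fset.
have a1 := release_prob_le1 (laplace_prob eps^-1) tau (count_in C) mZ
  (domf C `&` domf C')%fset.
apply: (privacy_loss_add (expR_gt0 eps) _ _ le1 common ge1).
- by rewrite ltW.
- by rewrite a0.
- by apply: quarter_mulrn_le => //; exact: ltW.
- by apply: quarter_mulrn_le => //; exact: ltW.
Qed.

Lemma dpssE k k' eps delta (X : stream U) (Z : set {fmap U -> R}) :
  dpss X k k' eps delta Z = law (laplace_prob eps^-1)
    (Num.max ((size X)%:R / k%:R - eps^-1 * ln (2 / delta))
      ((size X)%:R / k'%:R + 1 + eps^-1 * ln (2 / delta)))
    (domf (ss X k')) (count_in (ss X k')) Z.
Proof. by rewrite -dpss_law. Qed.

End OutputPrivacy.

Theorem theorem1 (R : realType) (U : choiceType) (eps delta : R) (k k' : nat)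
    (eps_gt0 : 0 < eps) (delta_gt0 : 0 < delta) (delta_lt1 : delta < 1)
    (k_gt0 : (0 < k)%N) (k'_gt0 : (0 < k')%N) :
  differentially_private eps delta
    (fun X : stream U => dpss X k k' eps delta).
Proof.
(* Neighboring streams have equal length, hence the same threshold. *)
move=> X X' XX' Z mZ; rewrite !dpssE (neighboring_size XX').
apply: close_laws_le => //; first by rewrite delta_gt0.
exact: ss_close.
Qed.
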